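(* For positive integers $n$, $$B_n^-(s,t,q)=q^{n^2}s^{k+1}t^kB_n^+(s^{-1},t^{-1},q^{-1})\ \text{ when } n=2k+1,\qquad B_n^-(s,t,q)=q^{n^2}s^{k}t^kB_n^+(s^{-1},t^{-1},q^{-1})\ \text{ when } n=2k.$$ Therefore, $$B_n(s,t,q)=B_n^+(s,t,q)+q^{n^2}s^{k+1}t^kB_n^+(s^{-1},t^{-1},q^{-1})\ \text{ when } n=2k+1,$$ $$B_n(s,t,q)=B_n^+(s,t,q)+q^{n^2}s^{k}t^kB_n^+(s^{-1},t^{-1},q^{-1})\ \text{ when } n=2k.$$
   Context: $\mathfrak{B}_n$ is the group of permutations $\pi$ of $\{\pm1,\dots,\pm n\}$ with $\pi(-i)=-\pi(i)$; write $\pi_i=\pi(i)$ and set $\pi_0=0$. For $\pi\in\mathfrak{B}_n$: $\mathrm{edes}_B(\pi)$ (resp. $\mathrm{odes}_B(\pi)$) is the number of even (resp. odd) indices $i\in\{0,1,\dots,n-1\}$ with $\pi_i>\pi_{i+1}$. The type B inversion number is $$\mathrm{inv}_B(\pi)=|\{1\le i<j\le n:\pi_i>\pi_j\}|+|\{1\le i<j\le n:-\pi_i>\pi_j\}|+|\{1\le i\le n:\pi_i<0\}|.$$ $\mathfrak{B}_n^+=\{\pi\in\mathfrak{B}_n:\pi_n>0\}$, $\mathfrak{B}_n^-=\mathfrak{B}_n\setminus\mathfrak{B}_n^+$. $B_n(s,t,q)$, $B_n^+(s,t,q)$, $B_n^-(s,t,q)$ denote the sums of $s^{\mathrm{edes}_B(\pi)}t^{\mathrm{odes}_B(\pi)}q^{\mathrm{inv}_B(\pi)}$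 over $\pi\in\mathfrak{B}_n$, $\mathfrak{B}_n^+$, $\mathfrak{B}_n^-$ respectively. *)

(* Defs.v *)
From mathcomp Require Import all_boot all_order all_fingroup all_algebra.

Set Implicit Arguments.
Unset Strict Implicit.
Unset Printing Implicit Defensive.

Import Order.TTheory GRing.Theory Num.Theory.
Local Open Scope ring_scope.

(* The set {+-1, ..., +-n}: the pair (b, i) stands for i + 1 if b is false and *)
(* for -(i + 1) if b is true.                                                  *)
Notation spoint n := (bool * 'I_n)%type.

Definition spoint_int n (x : spoint n) : int := (-1) ^+ x.1 * (x.2.+1)%:Z.

Definition spoint_opp n (x : spoint n) : spoint n := (~~ x.1, x.2).

Lemma spoint_int_inj n : injective (@spoint_int n).
Proof.
move=> [b i] [c j]; rewrite /spoint_int /=.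
by case: b; case: c; rewrite ?expr1 ?expr0 ?mulN1r ?mul1r // => e;
  congr (_, _); apply/val_inj; case: (oppr_inj e) || case: e.
Qed.

Lemma spoint_int_opp n (x : spoint n) :
  spoint_int (spoint_opp x) = - spoint_int x.
Proof.
by case: x => [[] i];
  rewrite /spoint_int /= ?expr1 ?expr0 ?mulN1r ?mul1r ?opprK.
Qed.

Definition signed_perms n : {set {perm spoint n}} :=
  [set p : {perm spoint n} | [forall x, p (spoint_opp x) == spoint_opp (p x)]].

Lemma signed_perms_group_set n : group_set (signed_perms n).
Proof.
apply/group_setP; split=> [|p r]; rewrite !inE.
  by apply/forallP=> x; rewrite !perm1.
move=> /forallP hp /forallP hr; apply/forallP=> x.
by rewrite !permM (eqP (hp x)) (eqP (hr _)).
Qed.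

Canonical signed_perms_group n := Group (signed_perms_group_set n).

(* p_i for 0 <= i <= n, with p_0 = 0 (and the junk value 0 for i > n).         *)
Definition entry n (p : {perm spoint n}) (i : nat) : int :=
  if i is j.+1 then
    if insub j is Some j' then spoint_int (p (false, j')) else 0
  else 0.

Definition edesB n (p : {perm spoint n}) : nat :=
  #|[set i : 'I_n | ~~ odd i & entry p i > entry p i.+1]|.

Definition odesB n (p : {perm spoint n}) : nat :=
  #|[set i : 'I_n | odd i & entry p i > entry p i.+1]|.

(* An ordinal i : 'I_n stands for the position i + 1 in {1, ..., n}.           *)
Definition invB n (p : {perm spoint n}) : nat :=
  (#|[set ij : 'I_n * 'I_n | (ij.1 < ij.2)%N
        & (entry p ij.1.+1 > entry p ij.2.+1)%R]|
   + #|[set ij : 'I_n * 'I_n | (ij.1 < ij.2)%N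
        & (- entry p ij.1.+1 > entry p ij.2.+1)%R]|
   + #|[set i : 'I_n | (entry p i.+1 < 0)%R]|)%N.

Definition signed_perms_pos n : {set {perm spoint n}} :=
  [set p in signed_perms n | 0 < entry p n].

Definition signed_perms_neg n : {set {perm spoint n}} :=
  signed_perms n :\: signed_perms_pos n.

(* The variables s, t, q are elements of an arbitrary commutative ring, so     *)
(* that they may be specialized to (Laurent) indeterminates.                   *)
Definition genB n (A : {set {perm spoint n}}) (R : comNzRingType) (s t q : R)
    : R :=
  \sum_(p in A) s ^+ edesB p * t ^+ odesB p * q ^+ invB p.

Definition B n (R : comNzRingType) (s t q : R) : R :=
  genB (signed_perms n) s t q.

Definition Bpos n (R : comNzRingType) (s t q : R) : R :=
  genB (signed_perms_pos n) s t q.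

Definition Bneg n (R : comNzRingType) (s t q : R) : R :=
  genB (signed_perms_neg n) s t q.

(* Main.v *)
Require Import Defs.
From mathcomp Require Import all_boot all_order all_fingroup all_algebra.

Set Implicit Arguments.
Unset Strict Implicit.

Import Order.TTheory GRing.Theory Num.Theory.
Local Open Scope ring_scope.

(** Composing a signed permutation [p] with the central element [x |-> -x]
    negates every entry [p_1, ..., p_n].  This is a bijection between the signed
    permutations with [p_n < 0] and those with [p_n > 0], and it complements all
    three statistics.  Indeed the numbers [0, p_1, ..., p_n] have pairwise
    distinct absolute values ([entry_neq]), so each of the comparisons counted
    by [edesB], [odesB] and [invB] is strict one way or the other, and negation
    reverses it ([ltrN_entry]).  A statistic of [p] and the same statistic of
    [-p] therefore add up to the number of comparisons it ranges over: there
    are [uphalf n] even and [n./2] odd positions below [n], and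
    [2 * 'C(n, 2) + n = n ^ 2] comparisons for [invB].  Reindexing the sum along
    the bijection then sends each exponent [a] to [N - a], which is the
    substitution of inverses, up to the monomial of exponents [N]. *)

Lemma spoint_oppK n : involutive (@spoint_opp n).
Proof. by case=> b i; rewrite /spoint_opp /= negbK. Qed.

Definition negate_perm n : {perm spoint n} := perm (can_inj (@spoint_oppK n)).

Lemma negate_perm_signed n : negate_perm n \in signed_perms n.
Proof. by rewrite inE; apply/forallP=> x; rewrite !permE. Qed.

Lemma entryS n (p : {perm spoint n}) (i : 'I_n) :
  entry p i.+1 = spoint_int (p (false, i)).
Proof.
rewrite /entry insubT //= => lt_in.
by congr (spoint_int (p (_, _))); apply/val_inj.
Qed.

Lemma entry_negate n (p : {perm spoint n}) i :
  entry (p * negate_perm n)%g i = - entry p i.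
Proof.
case: i => [|i] /=; first by rewrite oppr0.
by case: insubP => [j _ _|_]; rewrite ?oppr0 // permM permE spoint_int_opp.
Qed.

Lemma spoint_int_neq0 n (x : spoint n) : spoint_int x != 0.
Proof. by rewrite /spoint_int mulf_neq0 // signr_eq0. Qed.

(** Distinctness of absolute values: a signed permutation is injective and
    commutes with negation, so [p_i = - p_j] would force [i = - j], which is
    impossible for positive [i] and [j]. *)
Lemma entry_neq n (p : {perm spoint n}) (i j : nat) :
    p \in signed_perms n -> (i < j)%N -> (j <= n)%N ->
  entry p i != entry p j /\ - entry p i != entry p j.
Proof.
move=> /[!inE] /forallP signed_p; case: j => // j lt_ij lt_jn.
rewrite (entryS p (Ordinal lt_jn)).
case: i lt_ij => [|i] lt_ij; first by rewrite oppr0 eq_sym spoint_int_neq0.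
have lt_in : (i < n)%N by apply: ltn_trans lt_jn.
rewrite (entryS p (Ordinal lt_in)) -spoint_int_opp -(eqP (signed_p _)).
rewrite !(inj_eq (@spoint_int_inj n)) !(inj_eq perm_inj).
by rewrite !xpair_eqE /= -!val_eqE /= (ltn_eqF (lt_ij : (i < j)%N)).
Qed.

(** Allowing [i = 0], where [p_0 = 0], lets the same equations cover the descents
    at position 0 and the sign conditions [p_j < 0] as well as the comparisons
    between two genuine entries; the second equation is for the pairs with
    [- p_i > p_j]. *)
Lemma ltrN_entry n (p : {perm spoint n}) (i j : nat) :
    p \in signed_perms n -> (i < j)%N -> (j <= n)%N ->
  (- entry p j < - entry p i) = ~~ (entry p j < entry p i)
  /\ (- entry p j < entry p i) = ~~ (entry p j < - entry p i).
Proof.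
move=> signed_p lt_ij le_jn.
have [neq neqN] := entry_neq signed_p lt_ij le_jn.
by rewrite ltrN2 ltrNl -!leNgt !lt_neqAle neq neqN.
Qed.

Lemma card_set_complement (T : finType) (D a b : pred T) :
    (forall x, D x -> b x = ~~ a x) ->
  (#|[set x | D x & a x]| + #|[set x | D x & b x]|)%N = #|[set x | D x]|.
Proof.
move=> ba; rewrite -(cardsID [set x | a x] [set x | D x]).
congr (_ + _)%N; apply: eq_card => x; rewrite !inE // andbC.
by case Dx: (D x); rewrite ?andbF //= ba ?andbT.
Qed.

Lemma card_odd_ord n : #|[set i : 'I_n | odd i]| = n./2.
Proof.
rewrite -sum1dep_card; elim: n => [|n IHn]; first by rewrite big_ord0.
rewrite big_mkcond big_ord_recr /= -big_mkcond /= IHn uphalf_half addnC.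
by case: (odd n).
Qed.

Lemma card_even_ord n : #|[set i : 'I_n | ~~ odd i]| = uphalf n.
Proof.
(* Even and odd positions are complementary, so it suffices to add [n./2]. *)
apply: (@addnI n./2).
rewrite uphalf_half addnCA addnn odd_double_half -[RHS]card_ord.
rewrite -(cardsC [set i : 'I_n | odd i]) card_odd_ord; congr (_ + _)%N.
by apply: eq_card => i; rewrite !inE.
Qed.

Lemma card_ltn_pairs n :
  #|[set ij : 'I_n * 'I_n | (ij.1 < ij.2)%N]| = 'C(n, 2).
Proof.
rewrite -bin2_sum big_mkord -sum1dep_card.
transitivity (\sum_(j < n) \sum_(i < n | (i < j)%N) 1)%N.
  by rewrite (exchange_big_dep predT) //= pair_big_dep.
apply: eq_bigr => j _; rewrite sum1_card -[RHS]card_ord.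
have widen_inj : injective (widen_ord (ltnW (ltn_ord j))).
  by move=> a b eq_ab; apply: val_inj; exact: (congr1 val eq_ab).
rewrite -(card_imset _ widen_inj).
apply: eq_card => i; apply/idP/imsetP => [lt_ij|[k _ ->]].
  by exists (Ordinal (lt_ij : (i < j)%N)) => //; apply: val_inj.
exact: (ltn_ord k).
Qed.

Lemma edesB_negate n (p : {perm spoint n}) : p \in signed_perms n ->
  (edesB p + edesB (p * negate_perm n)%g)%N = uphalf n.
Proof.
move=> signed_p; rewrite -card_even_ord; apply: card_set_complement => i _.
rewrite !entry_negate.
exact: (ltrN_entry signed_p (leqnn _) (ltn_ord i)).1.
Qed.

Lemma odesB_negate n (p : {perm spoint n}) : p \in signed_perms n ->
  (odesB p + odesB (p * negate_perm n)%g)%N = n./2.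
Proof.
move=> signed_p; rewrite -card_odd_ord; apply: card_set_complement => i _.
rewrite !entry_negate.
exact: (ltrN_entry signed_p (leqnn _) (ltn_ord i)).1.
Qed.

Lemma invB_negate n (p : {perm spoint n}) : p \in signed_perms n ->
  (invB p + invB (p * negate_perm n)%g)%N = (n ^ 2)%N.
Proof.
move=> signed_p; rewrite /invB addnACA [X in (X + _)%N]addnACA.
rewrite [X in (X + _ + _)%N](_ : _ = 'C(n, 2)); last first.
  rewrite -card_ltn_pairs; apply: card_set_complement => -[i j] lt_ij.
  rewrite !entry_negate.
  exact: (@ltrN_entry _ _ i.+1 j.+1 signed_p lt_ij (ltn_ord j)).1.
rewrite [X in (_ + X + _)%N](_ : _ = 'C(n, 2)); last first.
  rewrite -card_ltn_pairs; apply: card_set_complement => -[i j] lt_ij.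
  rewrite !entry_negate opprK.
  exact: (@ltrN_entry _ _ i.+1 j.+1 signed_p lt_ij (ltn_ord j)).2.
rewrite [X in (_ + X)%N](_ : _ = n); last first.
  rewrite -[RHS](card_ord n) -cardsT.
  apply: (@card_set_complement _ predT (fun i : 'I_n => entry p i.+1 < 0)
    (fun i : 'I_n => entry (p * negate_perm n)%g i.+1 < 0)) => i _.
  rewrite entry_negate.
  have [] := @ltrN_entry _ p 0 i.+1 signed_p (ltn0Sn _) (ltn_ord i).
  by rewrite /= oppr0.
(* The factor 2 is read as [2`!] to turn the binomial into [n * n.-1]. *)
rewrite addnn -muln2 -[X in (_ * X)%N]/(2`!) bin_ffact.
by rewrite ffactnS ffactn1; case: (n) => // m; rewrite -mulnSr -mulnn.
Qed.

Lemma negate_perm_neg n (p : {perm spoint n}) : (0 < n)%N ->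
  ((p * negate_perm n)%g \in signed_perms_neg n) = (p \in signed_perms_pos n).
Proof.
move=> n_gt0; rewrite in_setD /signed_perms_pos [in LHS]inE [RHS]inE.
rewrite (groupMr (G := signed_perms_group n)) ?negate_perm_signed //.
case signed_p: (p \in signed_perms n) => //=; rewrite andbT entry_negate.
have [neq0 _] := @entry_neq _ p 0 n signed_p n_gt0 (leqnn _).
by rewrite -leNgt oppr_le0 lt_neqAle neq0.
Qed.

Lemma exprV_complement (R : unitRingType) (u : R) (a b N : nat) :
  u \is a GRing.unit -> (a + b)%N = N -> u ^+ b = u ^+ N * u^-1 ^+ a.
Proof.
by move=> u_unit <-; rewrite exprVn addnC exprD mulrK // unitrX.
Qed.

(** Both parities at once: [uphalf n] is [k + 1] or [k] according to whether [n]
    is [2 * k + 1] or [2 * k], while [n./2] is [k] in both cases. *)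
Lemma Bneg_Bpos (R : comUnitRingType) (s t q : R) (n : nat) : (0 < n)%N ->
    s \is a GRing.unit -> t \is a GRing.unit -> q \is a GRing.unit ->
  Bneg n s t q
  = q ^+ (n ^ 2) * s ^+ uphalf n * t ^+ n./2 * Bpos n s^-1 t^-1 q^-1.
Proof.
move=> n_gt0 s_unit t_unit q_unit; rewrite /Bneg /Bpos /genB mulr_sumr.
rewrite (reindex_inj (mulIg (negate_perm n))) /=.
apply: eq_big => [p|p]; rewrite negate_perm_neg // inE => /andP[signed_p _].
rewrite (exprV_complement s_unit (edesB_negate signed_p)).
rewrite (exprV_complement t_unit (odesB_negate signed_p)).
rewrite (exprV_complement q_unit (invB_negate signed_p)).
by rewrite [X in X * _ = _]mulrACA [LHS]mulrACA [X in X * _ = _]mulrC !mulrA.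
Qed.

Lemma B_split (R : comNzRingType) (s t q : R) (n : nat) :
  B n s t q = Bpos n s t q + Bneg n s t q.
Proof.
rewrite /B /Bpos /Bneg /genB (big_setID (signed_perms_pos n)) /=.
by rewrite (setIidPr _) //; apply/subsetP=> p; rewrite inE => /andP[].
Qed.

Theorem theorem25 (R : comUnitRingType) (s t q : R) (n k : nat)
    (n_gt0 : (0 < n)%N)
    (s_unit : s \is a GRing.unit)
    (t_unit : t \is a GRing.unit)
    (q_unit : q \is a GRing.unit) :
  ((n = 2 * k + 1)%N ->
     Bneg n s t q
     = q ^+ (n ^ 2) * s ^+ (k + 1) * t ^+ k * Bpos n s^-1 t^-1 q^-1)
  /\ ((n = 2 * k)%N ->
     Bneg n s t q
     = q ^+ (n ^ 2) * s ^+ k * t ^+ k * Bpos n s^-1 t^-1 q^-1)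
  /\ ((n = 2 * k + 1)%N ->
     B n s t q
     = Bpos n s t q
       + q ^+ (n ^ 2) * s ^+ (k + 1) * t ^+ k * Bpos n s^-1 t^-1 q^-1)
  /\ ((n = 2 * k)%N ->
     B n s t q
     = Bpos n s t q
       + q ^+ (n ^ 2) * s ^+ k * t ^+ k * Bpos n s^-1 t^-1 q^-1).
Proof.
have neg_pos := Bneg_Bpos n_gt0 s_unit t_unit q_unit.
have oddE : (n = 2 * k + 1)%N -> uphalf n = (k + 1)%N /\ n./2 = k.
  by rewrite mul2n !addn1 => ->; rewrite /= doubleK uphalf_double.
have evenE : (n = 2 * k)%N -> uphalf n = k /\ n./2 = k.
  by rewrite mul2n => ->; rewrite doubleK uphalf_double.
by split; [|split; [|split]] => [/oddE|/evenE|/oddE|/evenE] [upE halfE];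
  rewrite ?B_split neg_pos upE halfE.
Qed.
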